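(* Let $X$ be a zero-dimensional space which is not pseudocompact. Then the remainder $\beta_0X\setminus\upsilon_0X$ has at least $2^{2^{\aleph_0}}$ points.
   Context: A zero-dimensional space is a Hausdorff topological space with a base of clopen sets. A space is pseudocompact if every continuous real-valued function on it is bounded. The Banaschewski compactification $\beta_0X$ of a zero-dimensional space $X$ is the (unique up to homeomorphism) compact zero-dimensional space containing $X$ as a dense subspace such that every continuous function $X\to\{0,1\}$ extends continuously to $\beta_0X$. A space is $\mathbb{N}$-compact if it is homeomorphic to a closed subspace of $\mathbb{N}^\kappa$ for some cardinal $\kappa$ ($\mathbb{N}$ discrete). $\upsilon_0X$ is the $\mathbb{N}$-compact space containing $X$ as a dense subspace such that every continuous function $X\to\mathbb{Z}$ extends continuously to $\upsilon_0X\to\mathbb{Z}$; it is regarded as a subspace $X\subseteq\upsilon_0X\subseteq\beta_0X$, namely the set of $p\in\beta_0X$ such that the ultrafilter of clopen sets $\{U\subseteq X \text{ clopen}: p\in\mathrm{cl}_{\beta_0X}U\}$ has the countable intersection property. *)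

(* Defs.v *)
From HB Require Import structures.
From mathcomp Require Import all_boot all_order all_algebra.
From mathcomp Require Import all_classical all_reals all_analysis.

Set Implicit Arguments.
Unset Strict Implicit.
Unset Printing Implicit Defensive.

Import Order.TTheory GRing.Theory Num.Theory.
Import numFieldNormedType.Exports.

Local Open Scope classical_set_scope.
Local Open Scope ring_scope.

(* The library's [zero_dimensional] only asks that distinct points be separated
   by a clopen set; without compactness this does not give a clopen base. *)
Definition zero_dimensional_space (X : topologicalType) : Prop :=
  hausdorff_space X /\ basis [set U : set X | clopen U].

Definition pseudocompact (R : realType) (X : topologicalType) : Prop :=
  forall f : X -> R, continuous f -> bounded_fun f.

Definition topological_embedding (X Y : topologicalType) (e : X -> Y) : Prop :=
  injective e /\
  forall U : set X, open U <-> exists2 V : set Y, open V & e @^-1` V = U.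

(* [B], with [X] identified with its image under [e], is the Banaschewski
   compactification of [X].  The space {0,1} is [bool], which carries the
   discrete topology. *)
Definition banaschewski_compactification (X B : topologicalType) (e : X -> B) :
    Prop :=
  [/\ compact [set: B], zero_dimensional_space B, topological_embedding e,
      dense (range e) &
      forall f : X -> bool, continuous f ->
        exists2 g : B -> bool, continuous g & forall x, g (e x) = f x].

Definition clopen_ultrafilter (X B : topologicalType) (e : X -> B) (p : B) :
    set (set X) :=
  [set U | clopen U /\ closure (e @` U) p].

Definition countable_intersection_property (T : Type) (F : set (set T)) : Prop :=
  forall G : set (set T), G `<=` F -> countable G ->
    \bigcap_(U in G) U !=set0.

(* The N-compactification of [X], as a subspace of [B]. *)
Definition upsilon0 (X B : topologicalType) (e : X -> B) : set B :=
  [set p | countable_intersection_property (clopen_ultrafilter e p)].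

(* Main.v *)
Require Import Defs.
From mathcomp Require Import all_boot all_order all_algebra.
From mathcomp Require Import all_classical all_reals all_analysis.
From mathcomp Require Import lra.

Import Order.TTheory GRing.Theory Num.Theory.
Import numFieldNormedType.Exports.

Local Open Scope classical_set_scope.
Local Open Scope card_scope.

(** The absolute value of an unbounded continuous real function spreads out a sequence of
    points whose values are more than [1] apart.  Clopen neighbourhoods of these
    points on which the function varies by less than [1/3] form a discrete
    family, so every union of members is clopen, and [X] maps onto the discrete
    space of natural numbers ([nonpseudocompact_onto_nat]), hence onto any
    nonempty countable discrete space.

    The countable set used here is [code], which carries [2^aleph_0] many
    independent subsets [indep S], indexed by the sets [S] of naturals:
    for every family [F] of sets of naturals, the sets [indep S] for [S] in [F]
    and the complements of [indep S] for [S] outside [F] generate a proper filter,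
    even together with the tails [tail N], whose intersection is empty
    ([pattern_nonempty]).  Pulling this filter back to [X] and clustering it in
    the compact space [B] yields a point [p F].

    Two different families disagree on some [S], so that one of the two points
    is in the closure of the pullback of [indep S] and the other in the closure
    of its complement.  These closures are disjoint because two-valued continuous
    functions extend to [B] ([closure_image_clopen_disjoint]); hence [p] is
    injective on the [2^(2^aleph_0)] families.  Finally the pullbacks of the
    tails belong to the clopen ultrafilter of [p F] and have empty intersection,
    which puts [p F] in the remainder. *)

(** * Discrete families in spaces that are not pseudocompact *)

Lemma unbounded_spread_sequence (R : realType) (T : Type) (h : T -> R) :
  (forall M : R, exists x, (M < h x)%R) ->
  exists a : nat -> T, forall m n, (m < n)%N -> (h (a m) + 1 < h (a n))%R.
Proof.
move=> /choice[next nextP].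
exists (fun n => iter n (fun x => next (h x + 1)%R) (next 0%R)) => m.
elim=> [//|n IH]; rewrite ltnS leq_eqVlt => /predU1P[->|/IH lt_mn] /=.
  exact: nextP.
apply: lt_trans lt_mn _; apply: le_lt_trans (nextP _).
by rewrite lerDl ler01.
Qed.

(** Near a point only one member of the family matters, so local membership in
    the closure of the union is membership in the closure of that member. *)
Lemma discrete_family_clopen_bigcup {X : topologicalType} {I : Type}
    (U : I -> set X) (clopU : forall i, clopen (U i))
    (discU : forall x : X, exists2 V, nbhs x V &
      forall i j, V `&` U i !=set0 -> V `&` U j !=set0 -> i = j) (A : set I) :
  clopen (\bigcup_(i in A) U i).
Proof.
split; first by apply: bigcup_open => i _; case: (clopU i).
move=> x clx; have [V Vx VU] := discU x.
have [y [[i Ai Uiy] Vy]] := clx V Vx.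
exists i => //; have [_] := clopU i; apply => W Wx.
have [z [[j Aj Ujz] [Vz Wz]]] := clx _ (filterI Vx Wx).
by rewrite (VU i j); [exists z|exists y|exists z].
Qed.

(** The points outside all the [U n] are sent to [0] along with [U 0]; the
    fibres over sets avoiding [0] are then unions of the family, and the other
    ones are complements of such unions. *)
Lemma discrete_family_onto_nat {X : topologicalType} (U : nat -> set X)
    (clopU : forall n, clopen (U n)) (U0 : forall n, U n !=set0)
    (discU : forall x : X, exists2 V, nbhs x V &
      forall i j, V `&` U i !=set0 -> V `&` U j !=set0 -> i = j) :
  exists2 g : X -> nat, (forall A, clopen (g @^-1` A)) &
    forall n, exists x, g x = n.
Proof.
have disjU x i j : U i x -> U j x -> i = j.
  move=> Uix Ujx; have [V /nbhs_singleton Vx VU] := discU x.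
  by apply: VU; exists x.
pose g x := xget 0%N [set n | U n x].
have gU n x : U n x -> g x = n.
  by rewrite /g; case: xgetP => [m _ /= Umx /(disjU _ _ _ Umx)//|/(_ n)].
have g_bigcup A : ~ A 0%N -> g @^-1` A = \bigcup_(n in A) U n.
  move=> A0; apply/seteqP; split => [x /=|x [n An Unx]/=]; last by rewrite (gU n).
  by rewrite {1}/g; case: xgetP => [n _ Unx An|//]; exists n.
exists g => [A|n]; last by have [x /gU] := U0 n; exists x.
have [A0|A0] := pselect (A 0%N); last first.
  by rewrite (g_bigcup _ A0); exact: discrete_family_clopen_bigcup.
rewrite -[A]setCK -preimage_setC; apply: (clopenC setT).
have nA0 : ~ (~` A) 0%N by apply.
by rewrite (g_bigcup _ nA0); exact: discrete_family_clopen_bigcup.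
Qed.

Lemma nonpseudocompact_onto_nat (R : realType) (X : topologicalType) :
  zero_dimensional_space X -> ~ pseudocompact R X ->
  exists2 g : X -> nat, (forall A, clopen (g @^-1` A)) &
    forall n, exists x, g x = n.
Proof.
move=> [_ [_ basisX]] /existsNP[f /not_implyP[fcont unbdd]].
pose h (x : X) : R := `|f x|%R.
have hnear x (r : R) : (0 < r)%R -> nbhs x [set y | (`|h x - h y| < r)%R].
  move=> r0; have hcont : {for x, continuous h}.
    by apply: continuous_comp; [exact: fcont|exact: norm_continuous].
  by have /cvgrPdist_lt/(_ r r0) := hcont.
have hunb (M : R) : exists x, (M < h x)%R.
  apply: contrapT => /forallNP hM; apply: unbdd; exists M; split=> //.
    exact: num_real.
  move=> N /ltW MN x _; apply: le_trans MN.
  by rewrite leNgt; apply/negP; exact: hM.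
have [a aP] := unbounded_spread_sequence R X h hunb.
have third_gt0 : (0 < 3^-1 :> R)%R by lra.
have sixth_gt0 : (0 < 6^-1 :> R)%R by lra.
have /choice[U UP] n : exists W : set X,
    [/\ clopen W, W (a n) & forall y, W y -> (`|h (a n) - h y| < 3^-1)%R].
  by have [W [? ?] Wh] := basisX _ _ (hnear (a n) _ third_gt0); exists W.
apply: (@discrete_family_onto_nat _ U) => [n|n|x].
- by case: (UP n).
- by exists (a n); case: (UP n).
exists [set y | (`|h x - h y| < 6^-1)%R]; first exact: hnear.
(* The two members meeting this neighbourhood have centres whose values differ
   by less than 1/3 + 1/6 + 1/6 + 1/3 = 1. *)
have sep m n : (m < n)%N ->
    [set y | (`|h x - h y| < 6^-1)%R] `&` U m !=set0 ->
    [set y | (`|h x - h y| < 6^-1)%R] `&` U n !=set0 -> False.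
  move=> /aP amn [y [/= xy Umy]] [z [/= xz Unz]].
  have [_ _ /(_ _ Umy) my] := UP m; have [_ _ /(_ _ Unz) nz] := UP n.
  move: xy xz my nz; rewrite !ltr_norml.
  by move=> /andP[? ?] /andP[? ?] /andP[? ?] /andP[? ?]; lra.
move=> m n Vm Vn; case: (ltngtP m n) => // lt_mn.
- by case: (sep m n).
- by case: (sep n m).
Qed.

(** * An independent family of subsets of a countable set *)

(** A length [n] with a finite list of Boolean words; the words of length [n] are
    read as subsets of the first [n] naturals.  The type is countable, yet the
    sets of naturals whose traces are listed can be prescribed freely at finitely
    many sets, which is the source of independence. *)
Definition code : Type := (nat * seq (seq bool))%type.

Definition trace (S : set nat) (n : nat) : seq bool :=
  mkseq (fun i => i \in S) n.

Definition indep (S : set nat) : set code := [set c | trace S c.1 \in c.2].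

Definition tail (N : nat) : set code := [set c | (N <= c.1)%N].

Definition pattern (F : set (set nat)) (s : seq (set nat)) (N : nat) :
    set code :=
  [set c | tail N c /\ forall S, S \in s -> (indep S c <-> F S)].

Lemma trace_separates (S T : set nat) :
  exists k, forall n, (k <= n)%N -> trace S n = trace T n -> S = T.
Proof.
have [[i STi]|/forallNP ST] := pselect (exists i, (i \in S) != (i \in T)).
  exists i.+1 => n lt_in /(congr1 (fun w => nth false w i)).
  by rewrite !nth_mkseq// => eqST; rewrite eqST eqxx in STi.
exists 0%N => n _ _; apply/seteqP; split=> i.
- by move=> /mem_set Si; apply/set_mem; have /negP/negPn/eqP <- := ST i.
- by move=> /mem_set Ti; apply/set_mem; have /negP/negPn/eqP -> := ST i.
Qed.

(** The length is taken so large that the finitely many sets in [s] have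
    different traces; the list then consists of the traces of those in [F]. *)
Lemma pattern_nonempty F s N : pattern F s N !=set0.
Proof.
have /choice[k kP] : forall ST : set nat * set nat, exists k, forall n,
    (k <= n)%N -> trace ST.1 n = trace ST.2 n -> ST.1 = ST.2.
  by move=> ST; exact: trace_separates.
pose n := maxn N (\max_(ST <- [seq (T, T') | T <- s, T' <- s]) k ST)%N.
exists (n, [seq trace T n | T <- s & T \in F]); split => [/=|S sS].
  exact: leq_maxl.
split=> [/mapP[T]|FS]; last by apply: map_f; rewrite mem_filter mem_set.
rewrite mem_filter => /andP[/set_mem FT sT] eqST.
suff -> : S = T by [].
apply: (kP (S, T) n) eqST; rewrite leq_max; apply/orP; right.
by apply: (leq_bigmax_seq (S, T)) => //; exact: allpairs_f.
Qed.

(** * Points of the compactification prescribed by families of sets *)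

(** The extension of the indicator function of [W] is locally constant at [p], so
    its value there cannot be approached both from [W] and from its complement. *)
Lemma closure_image_clopen_disjoint {X B : topologicalType} {e : X -> B}
    {p : B} (W : set X) :
  (forall f : X -> bool, continuous f ->
    exists2 g : B -> bool, continuous g & forall x, g (e x) = f x) ->
  clopen W -> closure (e @` W) p -> closure (e @` (~` W)) p -> False.
Proof.
move=> extend clopW clW clWC.
have [|g gcont gE] := extend (fun x => `[< W x >]).
  apply/continuousP => A _.
  have [At|At] := pselect (A true); have [Af|Af] := pselect (A false).
  - rewrite (_ : _ @^-1` _ = setT); first exact: openT.
    by apply/seteqP; split=> // x _ /=; case: asboolP.
  - rewrite (_ : _ @^-1` _ = W); first by case: clopW.
    by apply/seteqP; split=> x /=; case: asboolP.
  - rewrite (_ : _ @^-1` _ = ~` W); first by case: (clopenC setT clopW).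
    by apply/seteqP; split=> x /=; case: asboolP.
  - rewrite (_ : _ @^-1` _ = set0); first exact: open0.
    by apply/seteqP; split=> // x /=; case: asboolP.
have gp : nbhs p (g @^-1` [set g p]).
  by apply: gcont; apply: open_nbhs_nbhs; split=> //; exact: discrete_open.
have [_ [[x Wx <-] /=]] := clW _ gp; rewrite gE asboolT// => gpT.
by have [_ [[y Wy <-] /=]] := clWC _ gp; rewrite gE asboolF// -gpT.
Qed.

Lemma compact_pattern_point {X B : topologicalType} (e : X -> B)
    (d : X -> code) (F : set (set nat)) :
  compact [set: B] -> (forall c, exists x, d x = c) ->
  exists p, forall s N, closure (e @` (d @^-1` pattern F s N)) p.
Proof.
move=> compB dsurj.
pose base (i : seq (set nat) * nat) := e @` (d @^-1` pattern F i.1 i.2).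
have baseF : Filter (filter_from setT base).
  apply: filter_from_filter => [|[s M] [t N] _ _]; first by exists ([::], 0%N).
  exists (s ++ t, maxn M N) => // _ [x [/= xMN xF] <-].
  move: xMN; rewrite /tail /= geq_max => /andP[xM xN].
  by split; exists x => //; split=> // S iS; apply: xF; rewrite mem_cat iS ?orbT.
have properF : ProperFilter (filter_from setT base).
  apply: filter_from_proper => -[s N] _ /=.
  have [c cP] := pattern_nonempty F s N; have [x dx] := dsurj c.
  by exists (e x); exists x => //=; rewrite dx.
have [|p [_ clp]] := compB _ properF; first exact: filterT.
by exists p => s N V pV; apply: clp => //; exists (s, N).
Qed.

Theorem proposition3p5 (R : realType) (X B : topologicalType) (e : X -> B)
    (hX : zero_dimensional_space X) (hB : banaschewski_compactification e)
    (hR : ~ pseudocompact R X) :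
  [set: set (set nat)] #<= [set: B] `\` upsilon0 e.
Proof.
have [compB _ _ _ extend] := hB.
have [g gclop gsurj] := nonpseudocompact_onto_nat R X hX hR.
pose d x : code := odflt (0%N, [::]) (unpickle (g x)).
have dclop (A : set code) : clopen (d @^-1` A).
  exact: (gclop [set n | A (odflt (0%N, [::]) (unpickle n))]).
have dsurj c : exists x, d x = c.
  by have [x gx] := gsurj (pickle c); exists x; rewrite /d gx pickleK.
have /choice[p pP] F := compact_pattern_point e d F compB dsurj.
have closP F (A : set code) s N :
    pattern F s N `<=` A -> closure (e @` (d @^-1` A)) (p F).
  by move=> sub; apply: (closure_subset _ (pP F s N)); apply: image_subset => x /sub.
have p_indep F S : F S -> closure (e @` (d @^-1` indep S)) (p F).
  move=> FS; apply: (closP F _ [:: S] 0%N) => c [_ cP].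
  by apply/(cP S) => //; rewrite inE.
have p_indepC F S : ~ F S -> closure (e @` (~` (d @^-1` indep S))) (p F).
  move=> FS; apply: (closP F (~` indep S) [:: S] 0%N) => c [_ cP] cS.
  by apply: FS; apply/(cP S) => //; rewrite inE.
have p_sub F G : p F = p G -> F `<=` G.
  move=> pFG S FS; apply: contrapT => GS.
  apply: (closure_image_clopen_disjoint _ extend (dclop (indep S)) (p_indep F S FS)).
  by rewrite pFG; exact: p_indepC.
have p_inj : {in [set: set (set nat)] &, injective p}.
  by move=> F G _ _ pFG; apply/seteqP; split; apply: p_sub.
have p_remainder F : ~ upsilon0 e (p F).
  move=> /(_ (range (fun N => d @^-1` tail N)))[].
  - move=> _ [N _ <-]; split; first exact: dclop.
    by apply: (closP F _ [::] N) => c [].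
  - exact: card_image_le.
  - move=> x /(_ (d @^-1` tail (d x).1.+1)) /=.
    by rewrite /tail /= ltnn => xP; suff: false by []; apply: xP; exists (d x).1.+1.
apply: (@card_le_trans _ _ _ (p @` [set: set (set nat)])).
  by have := inj_card_eq p_inj; rewrite card_eq_le => /andP[].
by apply: subset_card_le => _ [F _ <-]; split=> //; exact: p_remainder.
Qed.
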